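(* Let $0<\gamma\le 1$ be a discount factor, let $K\in\mathcal{S}_{\gamma}$, and let $$\alpha=\frac{\underline{\sigma}(Q+K^{\top}RK)}{J_{\gamma}(K)-\underline{\sigma}(Q+K^{\top}RK)}.$$ If $\gamma'>0$ satisfies $\gamma'\le(1+\alpha)\gamma$, then $K\in\mathcal{S}_{\gamma'}$.
   Context: Consider the discrete-time linear time-invariant system $x_{t+1}=Ax_t+Bu_t$, $x_0\sim\mathcal{D}$, with $x_t\in\mathbb{R}^n$, $u_t\in\mathbb{R}^m$ and $(A,B)$ controllable. The distribution $\mathcal{D}$ has zero mean, covariance $\mathbb{E}[x_0x_0^{\top}]=I$ and bounded support: $\|x_0\|\le d$ for some constant $d>0$. The matrices $Q>0$, $R>0$ are symmetric positive definite penalty matrices. A policy is a gain matrix $K\in\mathbb{R}^{m\times n}$. Its discounted LQR cost is $J_{\gamma}(K)=\mathbb{E}_{x_0}\sum_{t=0}^{\infty}\gamma^t(x_t^{\top}Qx_t+u_t^{\top}Ru_t)$ subject to the system dynamics and $u_t=-Kx_t$. For $\gamma>0$, $\mathcal{S}_{\gamma}=\{K : \sqrt{\gamma}\,\rho(A-BK)<1\}$, where $\rho(\cdot)$ is the spectral radius. $\underline{\sigma}(\cdot)$ denotes the minimal singular value.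
   Formalization: For n=1 the equality γ'=(1+α)γ is excluded, since the claim fails there (A=1/2, B=Q=R=1, K=0, γ=1, x_0=±1 gives α=3, γ'=4 and √γ' ρ(A-BK)=1); when J_γ(K) equals the minimal singular value, α is read as +∞. *)

(* Defs.v *)
From mathcomp Require Import all_boot all_order all_algebra.
From mathcomp Require Import all_classical all_reals all_analysis.
From mathcomp Require Import complex.

Set Implicit Arguments.
Unset Strict Implicit.
Unset Printing Implicit Defensive.

Import Order.TTheory GRing.Theory Num.Theory.

Local Open Scope classical_set_scope.
Local Open Scope ring_scope.

Section Matrices.
Variable R : realType.

Definition posdefmx (n : nat) (M : 'M[R]_n) : Prop :=
  M^T = M /\ forall x : 'cV[R]_n, x != 0 -> 0 < (x^T *m M *m x) 0 0.

Definition enorm (n : nat) (x : 'cV[R]_n) : R :=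
  Num.sqrt (\sum_(i < n) x i 0 ^+ 2).

(* The eigenvalues are the complex ones, so M is first mapped into R[i].  For
   0 < n the set of their moduli is nonempty and finite, so sup is a maximum. *)
Definition spectral_radius (n : nat) (M : 'M[R]_n) : R :=
  sup [set Normc.normc l |
        l in [set l : R[i] | eigenvalue (map_mx (real_complex R) M) l]].

(* The singular values of M are the square roots of the eigenvalues of M^T M,
   which are all real.  For 0 < n they form a nonempty finite set, so inf is a
   minimum. *)
Definition min_singular_value (n : nat) (M : 'M[R]_n) : R :=
  inf [set Num.sqrt l | l in [set l : R | eigenvalue (M^T *m M) l]].

End Matrices.

Section LinearSystem.
Variables (R : realType) (n m : nat) (A : 'M[R]_n) (B : 'M[R]_(n, m)).

(* State at time t of x_{t+1} = A x_t + B u_t with u_t = pi t x_t: open-loop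
   inputs ignore the second argument of pi, state feedback ignores the first. *)
Fixpoint lti_state (pi : nat -> 'cV[R]_n -> 'cV[R]_m) (x0 : 'cV[R]_n)
    (t : nat) : 'cV[R]_n :=
  if t is s.+1 then
    let x := lti_state pi x0 s in A *m x + B *m pi s x
  else x0.

Definition controllable : Prop :=
  forall x0 x1 : 'cV[R]_n, exists (N : nat) (u : nat -> 'cV[R]_m),
    lti_state (fun t _ => u t) x0 N = x1.

Definition feedback (K : 'M[R]_(m, n)) (x : 'cV[R]_n) : 'cV[R]_m := - (K *m x).

Definition stabilizing_gains (gamma : R) : set 'M[R]_(m, n) :=
  [set K | Num.sqrt gamma * spectral_radius (A - B *m K) < 1].

Definition stage_cost (Q : 'M[R]_n) (Ru : 'M[R]_m) (x : 'cV[R]_n)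
    (u : 'cV[R]_m) : R :=
  (x^T *m Q *m x) 0 0 + (u^T *m Ru *m u) 0 0.

(* The law of x0 plays the role of the initial distribution.  The cost takes
   values in the extended reals: it is +oo when the series diverges. *)
Definition lqr_cost (d : measure_display) (T : measurableType d)
    (P : probability T R) (x0 : T -> 'cV[R]_n)
    (Q : 'M[R]_n) (Ru : 'M[R]_m) (gamma : R) (K : 'M[R]_(m, n)) : \bar R :=
  (\int[P]_w \sum_(0 <= t <oo)
     (let x := lti_state (fun=> feedback K) (x0 w) t in
      gamma ^+ t * stage_cost Q Ru x (feedback K x))%:E)%E.

End LinearSystem.

Section InitialState.
Variables (R : realType) (d : measure_display) (T : measurableType d).
Variables (P : probability T R) (n : nat) (x0 : T -> 'cV[R]_n).

(* Matrices carry no sigma-algebra in the library; measurability into R^n is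
   measurability of every coordinate. *)
Definition random_vector : Prop :=
  forall i : 'I_n, measurable_fun setT (fun w => x0 w i 0).

Definition zero_mean : Prop :=
  forall i : 'I_n, ('E_P[fun w => x0 w i 0%R] = 0)%E.

Definition identity_second_moment : Prop :=
  forall i j : 'I_n,
    ('E_P[fun w => (x0 w *m (x0 w)^T) i j] = ((1%:M : 'M[R]_n) i j)%:E)%E.

Definition bounded_support (b : R) : Prop := {ae P, forall w, enorm (x0 w) <= b}.

End InitialState.

(* Main.v *)
Require Import Defs.
From mathcomp Require Import all_boot all_order all_algebra.
From mathcomp Require Import all_classical all_reals all_analysis.
From mathcomp Require Import complex ring lra.

Set Implicit Arguments.
Unset Strict Implicit.
Unset Printing Implicit Defensive.

From mathcomp Require Import measurable_realfun.
Import Order.TTheory GRing.Theory Num.Theory.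
Import numFieldNormedType.Exports.
Local Open Scope classical_set_scope.
Local Open Scope ring_scope.

(** Write F = A - B K for the closed-loop matrix, M = Q + K^T Ru K, s for the
least singular value of M and rho for the spectral radius of F.  Under u = - K x
the state is F^t x_0 and the stage cost is the quadratic form of M at that state.
Three facts bound the cost from below.
- As M is symmetric positive definite, the spectral theorem gives
  s |x|^2 <= x^T M x ([min_singular_value_quadratic]).
- As x_0 has identity second moment, E |G x_0|^2 is the squared Frobenius norm
  of G ([integral_sqnorm]).
- The Frobenius norm dominates the modulus of every complex eigenvalue, and the
  eigenvalues of F^t contain the powers of those of F, so the norm of F^t is at
  least rho^t ([spectral_radius_le_frobenius]); for t = 0 its square is n.

Hence, with q = gamma rho^2 < 1,
  J >= s (n + q + q^2 + ...) = s (n - 1 + 1 / (1 - q))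
([lqr_cost_ge_geometric]).  If J is finite, this rearranges to
  s q + s (n - 1) (1 - q) <= (J - s) (1 - q),
so (1 + alpha) q <= 1, and strictly so when n > 1.  Multiplying the hypothesis on
gamma' by rho^2 yields gamma' rho^2 < 1: for n > 1 the strictness comes from the
cost bound, for n = 1 from the hypothesis.  In the degenerate cases s = 0 and
J = +oo one has alpha = 0, hence gamma' <= gamma, and when rho = 0 every positive
discount factor is admissible. *)

(** * Eigenvalues, spectral radius and the Frobenius norm *)

Section Frobenius.
Context {R : realType}.

Definition sqnorm n (x : 'cV[R]_n) : R := \sum_i x i 0 ^+ 2.
Definition sqfrobenius m n (G : 'M[R]_(m, n)) : R := \sum_i \sum_j G i j ^+ 2.

Lemma sum_sqr_eq0 (I : finType) (a : I -> R) :
  \sum_i a i ^+ 2 = 0 -> forall i, a i = 0.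
Proof.
move=> a0 i; apply/eqP; rewrite -sqrf_eq0; apply/eqP.
by apply: (psumr_eq0P _ a0) => // j _; exact: sqr_ge0.
Qed.

Lemma sum_sqr_ge0 (I : finType) (a : I -> R) : 0 <= \sum_i a i ^+ 2.
Proof. by apply: sumr_ge0 => i _; exact: sqr_ge0. Qed.

Lemma cauchy_schwarz_sum (I : finType) (a b : I -> R) :
  (\sum_i a i * b i) ^+ 2 <= (\sum_i a i ^+ 2) * (\sum_i b i ^+ 2).
Proof.
have [a0|a0] := eqVneq (\sum_i a i ^+ 2) 0.
  rewrite a0 mul0r big1 ?expr0n// => i _.
  by rewrite (sum_sqr_eq0 a0) mul0r.
set s := \sum_i a i ^+ 2; set p := \sum_i a i * b i.
have s0 : 0 < s by rewrite lt_def a0 sum_sqr_ge0.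
have : 0 <= \sum_i (s * b i - p * a i) ^+ 2 by exact: sum_sqr_ge0.
have -> : \sum_i (s * b i - p * a i) ^+ 2
        = s * (s * (\sum_i b i ^+ 2) - p ^+ 2).
  under eq_bigr => i _.
    rewrite (_ : _ ^+ 2 = s ^+ 2 * b i ^+ 2 - 2 * s * p * (a i * b i)
                        + p ^+ 2 * a i ^+ 2); last by ring.
    over.
  rewrite big_split sumrB /= -!mulr_sumr -/s -/p.
  by ring.
by rewrite pmulr_rge0// subr_ge0.
Qed.

Lemma normc_sum (I : finType) (z : I -> R[i]) :
  Normc.normc (\sum_i z i) <= \sum_i Normc.normc (z i).
Proof.
elim/big_ind2 : _ => //=.
  by rewrite le_eqVlt; apply/orP; left; apply/eqP; exact: Normc.normc0.
move=> x1 x2 y1 y2 h1 h2.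
exact: (le_trans (le_normcD _ _) (lerD h1 h2)).
Qed.

Lemma normc_ge0 (z : R[i]) : 0 <= Normc.normc z.
Proof. by case: z => a b; exact: sqrtr_ge0. Qed.

Lemma normc_real (x : R) : Normc.normc (real_complex R x) = `|x|.
Proof. by rewrite /= expr0n addr0 sqrtr_sqr. Qed.

Arguments normc_sum {I} z.
Arguments cauchy_schwarz_sum {I} a b.

(** Taking norms in v G = l v for a row eigenvector v bounds |l| |v| by |v| times
the Frobenius norm, by Cauchy-Schwarz applied to each column of G. *)
Lemma eigenvalue_le_frobenius n (G : 'M[R]_n) (l : R[i]) :
  eigenvalue (map_mx (real_complex R) G) l ->
  Normc.normc l ^+ 2 <= sqfrobenius G.
Proof.
case/eigenvalueP => v vG v0.
pose N := \sum_i Normc.normc (v 0 i) ^+ 2.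
have N0 : 0 < N.
  rewrite lt_def sum_sqr_ge0 andbT.
  apply: contra v0 => /eqP N0; apply/eqP/rowP => i; rewrite mxE.
  by apply: Normc.eq0_normc; exact: (sum_sqr_eq0 N0).
rewrite -(ler_pM2l N0).
have -> : N * Normc.normc l ^+ 2 = \sum_j Normc.normc ((l *: v) 0 j) ^+ 2.
  rewrite mulr_suml; apply: eq_bigr => j _.
  by rewrite !mxE Normc.normcM exprMn mulrC.
rewrite -vG /sqfrobenius exchange_big mulr_sumr; apply: ler_sum => j _.
have -> : \sum_i G i j ^+ 2 = \sum_i `|G i j| ^+ 2.
  by apply: eq_bigr => i _; rewrite real_normK// num_real.
apply: le_trans (cauchy_schwarz_sum _ _).
rewrite ler_sqr ?nnegrE ?normc_ge0//; last first.
  by apply: sumr_ge0 => i _; rewrite mulr_ge0// normc_ge0.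
rewrite mxE (le_trans (normc_sum _))//; apply: ler_sum => i _.
by rewrite mxE Normc.normcM normc_real.
Qed.

Lemma eigenvalueX n (F : 'M[R]_n) (l : R[i]) t :
  eigenvalue (map_mx (real_complex R) F) l ->
  eigenvalue (map_mx (real_complex R) (F ^+ t)) (l ^+ t).
Proof.
case/eigenvalueP => v vF v0; apply/eigenvalueP; exists v => //.
elim: t => [|t IH]; first by rewrite !expr0 map_mx1 mulmx1 scale1r.
by rewrite exprSr map_mxM mulmxA IH -scalemxAl vF scalerA -exprSr.
Qed.

Lemma spectral_radius_ge0 n (F : 'M[R]_n) : 0 <= spectral_radius F.
Proof.
rewrite /spectral_radius; set E := (X in sup X).
have [[[x Ex] ubE]|/sup_out -> //] := pselect (has_sup E).
apply: (le_trans _ (ub_le_sup ubE Ex)).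
by case: Ex => l _ <-; exact: normc_ge0.
Qed.

(** Every eigenvalue modulus is at most the (2t)-th root of the squared Frobenius
norm of F^t.  Comparing with that root, rather than raising a maximizing
eigenvalue to the power t, passes to the supremum without showing that it is
attained. *)
Lemma spectral_radius_le_frobenius n (F : 'M[R]_n) t : (0 < t)%N ->
  (spectral_radius F ^+ t) ^+ 2 <= sqfrobenius (F ^+ t).
Proof.
move=> t0; rewrite -exprM.
have c0 : 0 <= sqfrobenius (F ^+ t).
  by apply: sumr_ge0 => i _; exact: sum_sqr_ge0.
have tn0 : (t * 2 != 0)%N by rewrite -lt0n muln_gt0 t0.
set c := sqfrobenius _ in c0 *.
pose y := c `^ ((t * 2)%:R^-1).
have yc : y ^+ (t * 2) = c.
  by rewrite -powR_mulrn ?powR_ge0// -powRrM mulVf ?powRr1// pnatr_eq0.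
rewrite -yc ler_pXn2r ?nnegrE ?spectral_radius_ge0 ?powR_ge0 ?lt0n//.
rewrite /spectral_radius; set E := (X in sup X).
have Ey : ubound E y.
  move=> _ [l /= El <-].
  rewrite -(@ler_pXn2r _ (t * 2)) ?nnegrE ?normc_ge0 ?powR_ge0 ?lt0n// yc exprM.
  have -> : Normc.normc l ^+ t = Normc.normc (l ^+ t).
    elim: t {t0 c0 tn0 c y yc} => [|t IH]; first by rewrite !expr0 Normc.normc1.
    by rewrite !exprS Normc.normcM IH.
  exact/eigenvalue_le_frobenius/eigenvalueX.
have [E0|/sup_out ->] := pselect (has_sup E); last exact: powR_ge0.
by apply: ge_sup => //; case: E0.
Qed.

End Frobenius.

(** * The least singular value of a positive definite matrix *)

Section MinSingularValue.
Context {R : realType}.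

Lemma min_singular_value_ge0 n (M : 'M[R]_n) : 0 <= min_singular_value M.
Proof.
rewrite /min_singular_value; set E := (X in inf X).
have [[E0 _]|/inf_out -> //] := pselect (has_inf E).
by apply: lb_le_inf => // _ [l _ <-]; exact: sqrtr_ge0.
Qed.

(** For a symmetric matrix the square of an eigenvalue l is an eigenvalue of
M^T M, so |l| is a singular value; positive definiteness makes l positive. *)
Lemma min_singular_value_le_eigenvalue n (M : 'M[R]_n) (l : R) :
  posdefmx M -> eigenvalue M l -> min_singular_value M <= l.
Proof.
move=> [Msym Mpos] /eigenvalueP[v vM v0].
have l0 : 0 < l.
  have vT0 : v^T != 0 by rewrite trmx_eq0.
  have := Mpos _ vT0; rewrite trmxK vM -scalemxAl mxE.
  rewrite pmulr_lgt0// mxE lt_def; apply/andP; split.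
    apply: contra v0 => /eqP h; apply/eqP/rowP => i; rewrite mxE.
    apply: (@sum_sqr_eq0 R _ (fun i => v 0 i)); rewrite -[RHS]h.
    by apply: eq_bigr => j _; rewrite mxE expr2.
  by apply: sumr_ge0 => j _; rewrite mxE -expr2 sqr_ge0.
apply: ge_inf; first by exists 0 => _ [k _ <-]; exact: sqrtr_ge0.
exists (l ^+ 2); last by rewrite sqrtr_sqr gtr0_norm.
apply/eigenvalueP; exists v => //.
by rewrite Msym mulmxA vM -scalemxAl vM scalerA expr2.
Qed.

(** The spectral theorem is applied over R[i], where M becomes U^* diag(D) U with
U unitary.  The entries of D are real eigenvalues of M, and in the coordinates
w = U x both |x|^2 and x^T M x become sums of |w_i|^2, the latter weighted
by D. *)
Lemma min_singular_value_quadratic n (M : 'M[R]_n) (x : 'cV[R]_n) :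
  posdefmx M -> min_singular_value M * sqnorm x <= (x^T *m M *m x) 0 0.
Proof.
move=> Mpd; have [Msym _] := Mpd.
pose f := real_complex R; pose Mc := map_mx f M.
have fconj (a : R) : (f a)^* = f a by apply/CrealP/complex_realP; exists a.
have Mh : Mc \is hermsymmx.
  apply/is_hermitianmxP; rewrite expr0 scale1r; apply/matrixP => i j.
  by rewrite !mxE fconj -[in RHS]Msym mxE.
have /orthomx_spectralP := hermitian_normalmx Mh.
have := spectral_unitarymx Mc.
have /mxOverP := hermitian_spectral_diag_real Mh.
set U := spectralmx Mc; set D := spectral_diag Mc => Dreal Uunit.
rewrite (invmx_unitary Uunit) => MUD.
have UtU : map_mx Num.Def.conjC U^T *m U = 1%:M.
  by rewrite -(invmx_unitary Uunit) mulVmx// unitarymx_unit.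
have UUt := unitarymxP Uunit.
have Dge i : f (min_singular_value M) <= D 0 i.
  have /complex_realP[l Dl] := Dreal 0 i.
  rewrite Dl lecR; apply: min_singular_value_le_eigenvalue => //.
  rewrite -(eigenvalue_map (real_complex R)); apply/eigenvalueP.
  exists (row i U).
    (* The i-th row of U is an eigenvector of M for the eigenvalue D_i. *)
    rewrite (_ : _ *: row i U = D 0 i *: row i U); last by rewrite Dl.
    rewrite -[map_mx _ M]/Mc -row_mul MUD !mulmxA UUt mul1mx.
    by apply/rowP => j; rewrite mul_diag_mx !mxE.
  apply/negP => /eqP Ui0; have /matrixP/(_ i i) := UUt.
  rewrite mxE big1 ?mxE ?eqxx.
    by move/eqP; rewrite eq_sym oner_eq0.
  by move=> j _; have /rowP/(_ j) := Ui0; rewrite !mxE => ->; rewrite mul0r.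
pose xc := map_mx f x; pose w := U *m xc.
have wt : map_mx Num.Def.conjC w^T = xc^T *m map_mx Num.Def.conjC U^T.
  rewrite /w trmx_mul map_mxM; congr (_ *m _).
  by apply/matrixP => i j; rewrite /xc !mxE; exact: fconj.
have wN : f (sqnorm x) = \sum_i (w i 0)^* * w i 0.
  transitivity ((map_mx Num.Def.conjC w^T *m w) 0 0); last first.
    by rewrite mxE; apply: eq_bigr => i _; rewrite !mxE.
  rewrite wt /w mulmxA -(mulmxA xc^T) UtU mulmx1 mxE [LHS]rmorph_sum/=.
  by apply: eq_bigr => i _; rewrite /xc !mxE expr2 [LHS]rmorphM.
have wM : f ((x^T *m M *m x) 0 0) = \sum_i D 0 i * ((w i 0)^* * w i 0).
  transitivity ((map_mx Num.Def.conjC w^T *m diag_mx D *m w) 0 0).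
    have -> : map_mx Num.Def.conjC w^T *m diag_mx D *m w = xc^T *m Mc *m xc.
      by rewrite wt MUD /w !mulmxA.
    transitivity ((map_mx f (x^T *m M *m x)) 0 0); first by rewrite [RHS]mxE.
    by rewrite !map_mxM map_trmx.
  rewrite mxE; apply: eq_bigr => i _.
  by rewrite mul_mx_diag !mxE mulrCA mulrA.
rewrite -lecR rmorphM /= -/f wN wM mulr_sumr; apply: ler_sum => i _.
by rewrite ler_wpM2r// mulrC -normCK exprn_ge0.
Qed.
End MinSingularValue.

(** * Second moments of linear images of a random vector *)

Section SecondMoment.
Context {R : realType} {d : measure_display} {T : measurableType d}.
Variable P : probability T R.

Lemma measurable_mulmx_cV m n (G : 'M[R]_(m, n)) (x : T -> 'cV[R]_n) :
  random_vector x -> random_vector (fun w => G *m x w).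
Proof.
move=> mx i; under eq_fun do rewrite mxE.
apply: measurable_sum => j; apply: measurable_funM => //; exact: mx.
Qed.

Lemma measurable_quadratic n (M : 'M[R]_n) (x : T -> 'cV[R]_n) :
  random_vector x -> measurable_fun setT (fun w => ((x w)^T *m M *m x w) 0 0).
Proof.
move=> mx; under eq_fun do rewrite -mulmxA mxE.
apply: measurable_sum => j; apply: measurable_funM.
  by under eq_fun do rewrite mxE; exact: mx.
exact: measurable_mulmx_cV.
Qed.

Lemma sqnormE n (x : 'cV[R]_n) : sqnorm x = (x^T *m 1%:M *m x) 0 0.
Proof.
by rewrite mulmx1 mxE; apply: eq_bigr => i _; rewrite mxE expr2.
Qed.

Lemma measurable_sqnorm n (x : T -> 'cV[R]_n) :
  random_vector x -> measurable_fun setT (fun w => sqnorm (x w)).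
Proof.
by move=> mx; under eq_fun do rewrite sqnormE; exact: measurable_quadratic.
Qed.

(** Each squared coordinate has a finite expectation, and |a b| <= a^2 + b^2. *)
Lemma integrable_coord_mul n (x : T -> 'cV[R]_n) (i j : 'I_n) :
  random_vector x -> identity_second_moment P x ->
  P.-integrable setT (fun w => (x w i 0 * x w j 0)%:E).
Proof.
move=> mx xcov.
have sqint k : P.-integrable setT (fun w => (x w k 0 ^+ 2)%:E).
  have mk : measurable_fun setT (fun w => x w k 0 ^+ 2).
    by apply: measurable_funX; exact: mx.
  apply/integrableP; split; first exact/measurable_EFinP.
  rewrite integral_fin_num_abs//.
  rewrite (_ : (\int[P]_w _)%E = 1%:E)//.
  have := xcov k k; rewrite expectation.unlock [1%:M k k]mxE eqxx => <-.
  by apply: eq_integral => w _; rewrite mxE big_ord1 mxE expr2.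
apply: (le_integrable _ _ _ (integrableD _ (sqint i) (sqint j))) => //.
  by apply/measurable_EFinP; apply: measurable_funM; exact: mx.
move=> w _ /=; rewrite lee_fin [leRHS]ger0_norm ?addr_ge0 ?sqr_ge0//.
move: (x w i 0) (x w j 0) => a b.
by rewrite ler_norml; apply/andP; split; nra.
Qed.

(** Expand |G x|^2 as the sum of (G^T G)_ij x_i x_j: the second moments select the
trace of G^T G, which is the squared Frobenius norm. *)
Lemma integral_sqnorm n m (G : 'M[R]_(m, n)) (x : T -> 'cV[R]_n) :
  random_vector x -> identity_second_moment P x ->
  (\int[P]_w (sqnorm (G *m x w))%:E = (sqfrobenius G)%:E)%E.
Proof.
move=> mx xcov; pose H := G^T *m G.
have -> : (fun w => (sqnorm (G *m x w))%:E)
  = (fun w => \sum_(p : 'I_n * 'I_n)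
       (H p.1 p.2)%:E * (x w p.1 0 * x w p.2 0)%:E)%E.
  apply/funext => w; rewrite sqnormE mulmx1 trmx_mul mulmxA -(mulmxA _ _ G) -/H.
  under eq_bigr do rewrite -EFinM; rewrite sumEFin; congr (_%:E).
  rewrite -mulmxA mxE.
  under eq_bigr => i _.
    rewrite !mxE big_distrr /=; over.
  rewrite pair_big /=; apply: eq_bigr => -[i j] _ /=; ring.
rewrite integral_sum//=; last first.
  by move=> p; apply: integrableZl => //; exact: integrable_coord_mul.
transitivity (\sum_(p : 'I_n * 'I_n) (H p.1 p.2 * (p.1 == p.2)%:R)%:E)%E.
  apply: eq_bigr => -[i j] _ /=.
  rewrite integralZl//; last exact: integrable_coord_mul.
  rewrite EFinM; congr (_ * _)%E.
  have := xcov i j; rewrite expectation.unlock [(1%:M : matrix _ _ _) i j]mxE => <-.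
  by apply: eq_integral => w _; rewrite mxE big_ord1 mxE.
rewrite sumEFin; congr (_%:E).
rewrite -(pair_big xpredT xpredT (fun i j => H i j * (i == j)%:R))/=.
transitivity (\sum_i H i i).
  apply: eq_bigr => i _; rewrite (bigD1 i)//= eqxx mulr1 big1 ?addr0// => j ji.
  by rewrite eq_sym (negPf ji) mulr0.
rewrite /sqfrobenius exchange_big; apply: eq_bigr => i _.
by rewrite mxE; apply: eq_bigr => j _; rewrite mxE expr2.
Qed.

End SecondMoment.

(** * The closed loop *)

Section ClosedLoop.
Context {R : realType} {n m : nat}.
Variables (A : 'M[R]_n) (B : 'M[R]_(n, m)) (K : 'M[R]_(m, n)).
Variables (Q : 'M[R]_n) (Ru : 'M[R]_m).
Hypotheses (hQ : posdefmx Q) (hRu : posdefmx Ru).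

Let F := A - B *m K.
Let M := Q + K^T *m Ru *m K.

Lemma lti_state_feedback (x : 'cV[R]_n) t :
  lti_state A B (fun=> feedback K) x t = F ^+ t *m x.
Proof.
elim: t => [|t IH] /=; first by rewrite expr0 mul1mx.
rewrite IH /feedback exprS -mulmxA /F mulmxBl mulmxN.
by rewrite !mulmxA.
Qed.

Lemma stage_cost_feedback (x : 'cV[R]_n) :
  stage_cost Q Ru x (feedback K x) = (x^T *m M *m x) 0 0.
Proof.
rewrite /stage_cost /feedback [(- _)^T]linearN/= !mulNmx mulmxN opprK trmx_mul.
by rewrite /M mulmxDr mulmxDl [in RHS]mxE !mulmxA.
Qed.

Lemma posdefmx_feedback : posdefmx M.
Proof.
case: hQ hRu => [Qsym Qpos] [Rsym Rpos]; split.
  by rewrite /M linearD/= !trmx_mul trmxK Qsym Rsym mulmxA.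
move=> x x0; rewrite /M mulmxDr mulmxDl mxE.
apply: ltr_wpDr; last exact: Qpos.
have -> : x^T *m (K^T *m Ru *m K) *m x = (K *m x)^T *m Ru *m (K *m x).
  by rewrite trmx_mul !mulmxA.
have [->|Kx0] := eqVneq (K *m x) 0; first by rewrite mulmx0 mxE.
exact/ltW/Rpos.
Qed.

End ClosedLoop.

Lemma sqfrobenius1 (R : realType) n : sqfrobenius (1%:M : 'M[R]_n) = n%:R.
Proof.
rewrite /sqfrobenius -[in RHS](card_ord n) -sumr_const; apply: eq_bigr => i _.
rewrite (bigD1 i)//= mxE eqxx expr1n big1 ?addr0// => j ji.
by rewrite mxE eq_sym (negPf ji) expr0n.
Qed.

(** * Lower bounds for the discounted cost *)

Section Cost.
Context {R : realType} {d : measure_display} {T : measurableType d}.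
Variables (P : probability T R) (n m : nat).
Variables (A : 'M[R]_n) (B : 'M[R]_(n, m)) (K : 'M[R]_(m, n)).
Variables (Q : 'M[R]_n) (Ru : 'M[R]_m) (x0 : T -> 'cV[R]_n).
Hypotheses (hQ : posdefmx Q) (hRu : posdefmx Ru).
Hypotheses (mx0 : random_vector x0) (x0cov : identity_second_moment P x0).
Variable gamma : R.
Hypothesis gamma_ge0 : 0 <= gamma.

Let F := A - B *m K.
Let s := min_singular_value (Q + K^T *m Ru *m K).

(** All stage costs are nonnegative, so the expectation may be exchanged with the
series and truncated after N terms, whether or not the series converges. *)
Lemma lqr_cost_ge_partial_sum N :
  ((s * \sum_(0 <= t < N) gamma ^+ t * sqfrobenius (F ^+ t))%:E
     <= lqr_cost A B P x0 Q Ru gamma K)%E.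
Proof.
have Mpd := posdefmx_feedback K hQ hRu.
have quad_ge0 t w : 0 <= ((F ^+ t *m x0 w)^T *m (Q + K^T *m Ru *m K)
                           *m (F ^+ t *m x0 w)) 0 0.
  apply: le_trans (min_singular_value_quadratic _ Mpd).
  by rewrite mulr_ge0 ?min_singular_value_ge0 ?sum_sqr_ge0.
have mFx t : random_vector (fun w => F ^+ t *m x0 w).
  exact: measurable_mulmx_cV.
rewrite /lqr_cost.
under eq_integral => w _ do
  under eq_eseriesr => t _ do rewrite lti_state_feedback stage_cost_feedback.
rewrite integral_nneseries//; last 2 first.
- move=> t; apply/measurable_EFinP; apply: measurable_funM => //.
  exact: measurable_quadratic.
- by move=> t w _; rewrite lee_fin mulr_ge0// exprn_ge0.
apply: le_trans (nneseries_lim_ge N _); last first.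
  move=> t _ _; apply: integral_ge0 => w _.
  by rewrite lee_fin mulr_ge0// exprn_ge0.
rewrite mulr_sumr -sumEFin; apply: lee_sum => t _.
rewrite mulrA EFinM -(integral_sqnorm _ mx0 x0cov).
rewrite -ge0_integralZl//; last 3 first.
- by apply/measurable_EFinP; exact: measurable_sqnorm.
- by move=> w _; rewrite lee_fin sum_sqr_ge0.
- by rewrite lee_fin mulr_ge0 ?min_singular_value_ge0// exprn_ge0.
apply: ge0_le_integral => //.
- move=> w _; rewrite -EFinM lee_fin !mulr_ge0 ?min_singular_value_ge0//.
    exact: exprn_ge0.
  exact: sum_sqr_ge0.
- apply/measurable_EFinP; apply: measurable_funM => //.
  exact: measurable_sqnorm.
- apply/measurable_EFinP; apply: measurable_funM => //.
  exact: measurable_quadratic.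
move=> w _; rewrite -EFinM lee_fin [s * _]mulrC -mulrA ler_wpM2l ?exprn_ge0//.
exact: min_singular_value_quadratic.
Qed.

(** The term t = 0 contributes n instead of 1, because the squared Frobenius norm
of the identity is n: this is the origin of the extra n - 1, and of the strict
inequality available in dimension at least two. *)
Lemma lqr_cost_ge_geometric : let q := gamma * spectral_radius F ^+ 2 in
  q < 1 ->
  ((s * (n%:R - 1 + (1 - q)^-1))%:E <= lqr_cost A B P x0 Q Ru gamma K)%E.
Proof.
move=> q q1; have := lqr_cost_ge_partial_sum.
have q0 : 0 <= q by rewrite mulr_ge0// sqr_ge0.
case: (lqr_cost A B P x0 Q Ru gamma K) => [j| |] jge; last 2 first.
- exact: leey.
- by have := jge 0%N.
rewrite lee_fin.
have : (fun N => s * (n%:R - 1 + series (geometric 1 q) N)) @ \oo -->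
    s * (n%:R - 1 + (1 - q)^-1).
  apply: cvgM; first exact: cvg_cst.
  apply: cvgD; first exact: cvg_cst.
  rewrite -[(1 - q)^-1]mul1r; apply: cvg_geometric_series.
  by rewrite ger0_norm.
move=> /cvgr_to_le; apply.
apply: filterS (nbhs_infty_ge 1). move=> [//|N _].
have := jge N.+1; rewrite lee_fin; apply: le_trans.
apply: ler_wpM2l; first exact: min_singular_value_ge0.
rewrite /series /geometric /= !big_nat_recl// !expr0 !mul1r sqfrobenius1.
rewrite addrA subrK lerD2l; apply: ler_sum => t _; rewrite mul1r.
rewrite exprMn ler_wpM2l ?exprn_ge0// -exprM mulnC exprM.
exact: spectral_radius_le_frobenius.
Qed.

End Cost.

(** * Discount factors admitting the gain *)

Lemma sqrt_mul_lt1 (R : realType) (a b : R) : 0 <= a -> 0 <= b ->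
  (Num.sqrt a * b < 1) = (a * b ^+ 2 < 1).
Proof.
move=> a0 b0; rewrite -[in RHS](sqr_sqrtr a0) -exprMn expr_lt1//.
by rewrite mulr_ge0// sqrtr_ge0.
Qed.

Theorem theorem1 (R : realType) (n m : nat) (hn : (0 < n)%N)
  (A : 'M[R]_n) (B : 'M[R]_(n, m)) (hAB : controllable A B)
  (disp : measure_display) (T : measurableType disp) (P : probability T R)
  (x0 : T -> 'cV[R]_n) (hx0 : random_vector x0)
  (hmean : zero_mean P x0) (hcov : identity_second_moment P x0)
  (d : R) (hd : 0 < d) (hsupp : bounded_support P x0 d)
  (Q : 'M[R]_n) (hQ : posdefmx Q) (Ru : 'M[R]_m) (hRu : posdefmx Ru)
  (gamma : R) (hgamma0 : 0 < gamma) (hgamma1 : gamma <= 1)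
  (K : 'M[R]_(m, n)) (hK : K \in stabilizing_gains A B gamma)
  (* alpha = sigma / (J - sigma), with the convention sigma / 0 = +oo *)
  (alpha : \bar R)
  (halpha : (alpha =
     (min_singular_value (Q + K^T *m Ru *m K))%:E /
     (lqr_cost A B P x0 Q Ru gamma K
        - (min_singular_value (Q + K^T *m Ru *m K))%:E))%E)
  (gamma' : R) (hgamma'0 : 0 < gamma')
  (hgamma' : (gamma'%:E <= (1 + alpha) * gamma%:E)%E)
  (* equality in the previous bound is excluded in dimension one, where the
     conclusion fails at the endpoint *)
  (hscalar : n = 1%N -> (gamma'%:E != (1 + alpha) * gamma%:E)%E) :
  K \in stabilizing_gains A B gamma'.
Proof.
move: hK; rewrite !inE /stabilizing_gains /=.
have rho_ge0 := spectral_radius_ge0 (A - B *m K).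
rewrite !sqrt_mul_lt1// ?ltW//.
have s_ge0 := min_singular_value_ge0 (Q + K^T *m Ru *m K).
have := lqr_cost_ge_geometric (A := A) (B := B) (K := K)
  hQ hRu hx0 hcov (ltW hgamma0).
move: halpha s_ge0 rho_ge0; cbv zeta.
set s := min_singular_value _; set r := spectral_radius _.
set J := lqr_cost _ _ _ _ _ _ _ _.
move=> alphaE s_ge0 r_ge0 Jge q_lt1; have {Jge} := Jge q_lt1.
have small : alpha = 0%E -> gamma' * r ^+ 2 < 1.
  move=> alpha0; move: hgamma'; rewrite alpha0 adde0 mul1e lee_fin => le_g.
  by apply: le_lt_trans q_lt1; rewrite ler_wpM2r// sqr_ge0.
have [s0|s_neq0] := eqVneq s 0.
  by move=> _; apply: small; rewrite alphaE s0 mul0e.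
have [r0|r_neq0] := eqVneq r 0; first by move=> _; rewrite r0 expr0n mulr0.
case: J alphaE => [j| |] alphaE //; last first.
  by move=> _; apply: small; rewrite alphaE addye// invey mule0.
rewrite lee_fin; set q := gamma * r ^+ 2 in q_lt1 *.
have s_gt0 : 0 < s by rewrite lt_def s_neq0.
have r2_gt0 : 0 < r ^+ 2 by rewrite exprn_gt0// lt_def r_neq0.
have q_gt0 : 0 < q by rewrite mulr_gt0.
have n1 : 0 <= n%:R - 1 :> R by rewrite subr_ge0 ler1n.
have q1 : 0 < 1 - q by rewrite subr_gt0.
set N : R := n%:R - 1 in n1 * => jge.
have sN_ge0 : 0 <= s * N * (1 - q) by rewrite !mulr_ge0// ltW.
(* The cost bound, cleared of its denominator. *)
have {}jge : s * q + s * N * (1 - q) <= (j - s) * (1 - q).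
  have : s * (N + (1 - q)^-1) * (1 - q) <= j * (1 - q) by rewrite ler_pM2r.
  rewrite [s * (N + _)]mulrDr [(s * N + _) * _]mulrDl divfK ?lt0r_neq0//.
  by lra.
have D_gt0 : 0 < j - s.
  rewrite -(pmulr_lgt0 _ q1); apply: lt_le_trans jge.
  by rewrite ltr_pwDl// mulr_gt0.
have gE : ((1 + alpha) * gamma%:E = ((1 + s / (j - s)) * gamma)%:E)%E.
  by rewrite alphaE -EFinB inver gt_eqF// -EFinM -EFinD -EFinM.
move: hgamma' hscalar; rewrite gE lee_fin eqe => le_g n1_neq.
have qE : (1 + s / (j - s)) * gamma * r ^+ 2 = (j * q) / (j - s).
  by rewrite /q; field; rewrite lt0r_neq0.
have [n1E|n_neq1] := eqVneq n 1%N.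
  have lt_g : gamma' < (1 + s / (j - s)) * gamma.
    by rewrite lt_neqAle n1_neq.
  rewrite (@lt_le_trans _ _ ((1 + s / (j - s)) * gamma * r ^+ 2))//.
    by rewrite ltr_pM2r.
  by rewrite qE ler_pdivrMr// mul1r; lra.
have N_gt0 : 0 < N by rewrite subr_gt0 ltr1n ltn_neqAle eq_sym n_neq1.
have sN_gt0 : 0 < s * N * (1 - q) by rewrite !mulr_gt0.
rewrite (@le_lt_trans _ _ ((1 + s / (j - s)) * gamma * r ^+ 2))//.
  by rewrite ler_pM2r.
by rewrite qE ltr_pdivrMr// mul1r; lra.
Qed.
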